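(* Let $\vartheta\in\{p,bp,r\}$. Suppose that the elements of the four-dimensional infinite matrices $E=(e_{mnkl})$ and $F=(f_{mnkl})$ are connected by the relation $$f_{mnkl}=\sum_{i=m-1}^{m}\sum_{j=n-1}^{n}(-1)^{m+n-i-j}e_{ijkl}$$ for all $k,l,m,n$, and let $\mu$ be any given space of double sequences. Then $E\in(\mu:\mathcal{C}_\vartheta(\Delta))$ if and only if $F\in(\mu:\mathcal{C}_\vartheta)$.
   Context: Scalars are in a fixed field $\mathbb{K}\in\{\mathbb{R},\mathbb{C}\}$. $\Omega$ is the vector space of all double sequences $x=(x_{mn})_{m,n\ge 0}$ in $\mathbb{K}$; all indices range over the nonnegative integers, and terms with a negative index (including $e_{ijkl}$ with $i=-1$ or $j=-1$) are taken to be $0$. A space of double sequences is a vector subspace of $\Omega$. The difference transform of $x\in\Omega$ is $\Delta x=((\Delta x)_{mn})$ with $(\Delta x)_{mn}=x_{mn}-x_{m,n-1}-x_{m-1,n}+x_{m-1,n-1}$. A double sequence $x$ converges in Pringsheim's sense to $l$ ($p\text{-}\lim x_{mn}=l$) if for every $\varepsilon>0$ there is $n_0$ with $|x_{mn}-l|<\varepsilon$ for all $m,n>n_0$. $\mathcal{C}_p$: double sequences convergent in Pringsheim's sense; $\mathcal{C}_{bp}$: those in $\mathcal{C}_p$ that are bounded; $\mathcal{C}_r$ (regularly convergent): those $x\in\mathcal{C}_p$ such that $(x_{mn})_n$ converges for every $m$ and $(x_{mn})_m$ converges for every $n$. For $\vartheta\in\{p,bp,r\}$, $\vartheta\text{-}\lim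 x_{mn}$ exists iff $x\in\mathcal{C}_\vartheta$, and is then the Pringsheim limit. $\mathcal{C}_\vartheta(\Delta)=\{x\in\Omega:\Delta x\in\mathcal{C}_\vartheta\}$. A four-dimensional matrix is a family $A=(a_{mnkl})_{m,n,k,l\ge 0}$ in $\mathbb{K}$. For $x\in\Omega$, $Ax$ has entries $(Ax)_{mn}=\vartheta\text{-}\sum_{k,l}a_{mnkl}x_{kl}:=\vartheta\text{-}\lim_{s,t\to\infty}\sum_{k=0}^s\sum_{l=0}^t a_{mnkl}x_{kl}$, and $Ax$ exists if all these limits exist. $A\in(\lambda:\nu)$ means that $Ax$ exists and belongs to $\nu$ for every $x\in\lambda$. *)

(* Defs.v *)
From HB Require Import structures.
From mathcomp Require Import all_boot all_order all_algebra.
From mathcomp Require Import all_classical all_reals all_analysis.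
From mathcomp.real_closed Require Import complex.

Set Implicit Arguments.
Unset Strict Implicit.
Unset Printing Implicit Defensive.

Import Order.TTheory GRing.Theory Num.Theory numFieldNormedType.Exports.

Local Open Scope classical_set_scope.
Local Open Scope ring_scope.

Variant scalar_kind := RealScalars | ComplexScalars.

Definition scalars (R : realType) (kind : scalar_kind) : numFieldType :=
  match kind with
  | RealScalars => R
  | ComplexScalars => R[i]
  end.

Variant conv_mode := Pringsheim | BoundedPringsheim | Regular.

Section DoubleSequences.
Variable K : numFieldType.

Definition dseq := nat -> nat -> K.

Definition matrix4 := nat -> nat -> nat -> nat -> K.

Implicit Types (x : dseq) (A : matrix4) (theta : conv_mode).

Definition seq_space (mu : set dseq) : Prop := GRing.submod_closed [in mu].

(* Integer indices, with the convention that terms with a negative index are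
   zero. *)
Definition zterm x (i j : int) : K :=
  match i, j with
  | Posz m, Posz n => x m n
  | _, _ => 0
  end.

Definition Delta x : dseq := fun m n =>
  zterm x m n - zterm x m (n%:Z - 1) - zterm x (m%:Z - 1) n
  + zterm x (m%:Z - 1) (n%:Z - 1).

(* The filter (\oo, \oo) is generated by the sets {(m, n) | m, n > n0}. *)
Definition p_cvg x : Prop := cvg (x p.1 p.2 @[p --> (\oo, \oo)]).

Definition p_lim x : K := lim (x p.1 p.2 @[p --> (\oo, \oo)]).

Definition C theta : set dseq :=
  match theta with
  | Pringsheim => [set x | p_cvg x]
  | BoundedPringsheim =>
      [set x | p_cvg x /\ [bounded x p.1 p.2 | p in [set: nat * nat]]]
  | Regular =>
      [set x | [/\ p_cvg x, forall m, cvg (x m n @[n --> \oo])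
                 & forall n, cvg (x m n @[m --> \oo])]]
  end.

Definition C_Delta theta : set dseq := [set x | C theta (Delta x)].

Definition partial_sum A x (m n : nat) : dseq := fun s t =>
  \sum_(0 <= k < s.+1) \sum_(0 <= l < t.+1) A m n k l * x k l.

Definition transform_exists theta A x : Prop :=
  forall m n, C theta (partial_sum A x m n).

(* Only meaningful under [transform_exists theta A x]; every mode assigns the
   Pringsheim limit. *)
Definition transform A x : dseq := fun m n => p_lim (partial_sum A x m n).

Definition matrix_class theta (lambda nu : set dseq) : set matrix4 :=
  [set A | forall x, lambda x ->
             transform_exists theta A x /\ nu (transform A x)].

Lemma p_limP x (l : K) :
  x p.1 p.2 @[p --> (\oo, \oo)] --> l <->
  forall e : K, 0 < e ->
    exists n0, forall m n, (n0 < m)%N -> (n0 < n)%N -> `|x m n - l| < e.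
Proof.
split=> [/cvgrPdist_lt xl e /xl [[P Q] /= [[a _ aP] [b _ bQ]] PQ]|xl].
  exists (maxn a b) => m n; rewrite !gtn_max => /andP[am _] /andP[_ bn].
  rewrite distrC; apply: (PQ (m, n)); split => /=.
    exact/aP/ltnW.
  exact/bQ/ltnW.
apply/cvgrPdist_lt => e /xl[n0 xn0].
exists ([set m | (n0 < m)%N], [set n | (n0 < n)%N]).
  by split; exists n0.+1.
by move=> [m n] [/= mn0 nn0]; rewrite distrC; exact: xn0.
Qed.

Lemma p_limE x (l : K) : x p.1 p.2 @[p --> (\oo, \oo)] --> l -> p_lim x = l.
Proof. by move=> xl; exact: (cvg_lim _ xl). Qed.

End DoubleSequences.

(* Main.v *)
Require Import Defs.
From HB Require Import structures.
From mathcomp Require Import all_boot all_order all_algebra.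
From mathcomp Require Import all_classical all_reals all_analysis.
From mathcomp.real_closed Require Import complex.
From mathcomp Require Import ring.

Import Order.TTheory GRing.Theory Num.Theory numFieldNormedType.Exports.

Local Open Scope classical_set_scope.
Local Open Scope ring_scope.

(** The matrix [F] is the difference transform of [E] in its first two indices.
    That transform involves, for each [(m, n)], finitely many entries and
    coefficients independent of [k, l], so it commutes with the partial sums
    ([partial_sum_Delta]).  The space [C theta] is closed under finite linear
    combinations and the Pringsheim limit is linear there, so it commutes with
    the limit as well ([p_lim_Delta]): wherever [E x] exists, so does [F x], and
    [F x] is the difference transform of [E x].

    Existence also passes from [F x] to [E x], because the difference transform
    is inverted by double summation ([sum_Delta]): a partial sum for [E] at
    [(m, n)] is the finite sum of those for [F] at the [(i, j)] with [i <= m]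
    and [j <= n].  Hence the conditions on [E x] and on [F x] coincide for each
    single [x]. *)

Section Difference.
Variable K : numFieldType.
Implicit Types (x y : dseq K) (A : matrix4 K) (theta : conv_mode).

Lemma telescope_sum_int (V : zmodType) (f : int -> V) (m : nat) :
  f (-1) = 0 -> \sum_(0 <= i < m.+1) (f i - f (i%:Z - 1)) = f m.
Proof.
move=> f0; elim: m => [|m IHm]; first by rewrite big_nat1 sub0r f0 subr0.
rewrite big_nat_recr //= IHm.
have -> : m.+1%:Z - 1 = m by rewrite -addn1 PoszD addrK.
by rewrite addrC subrK.
Qed.

(** Both sums telescope; the boundary terms have a negative index and so vanish
    under the zero extension. *)
Lemma sum_Delta x (m n : nat) :
  \sum_(0 <= i < m.+1) \sum_(0 <= j < n.+1) Delta x i j = x m n.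
Proof.
have inner i : \sum_(0 <= j < n.+1) Delta x i j =
    zterm x i n - zterm x (i%:Z - 1) n.
  rewrite -(@telescope_sum_int _ (fun j => zterm x i j - zterm x (i%:Z - 1) j)).
    by apply: eq_bigr => j _; rewrite /Delta; ring.
  by case: (i%:Z - 1) => ?; rewrite /= subrr.
under eq_bigr do rewrite inner.
by rewrite (@telescope_sum_int _ (fun i => zterm x i n)).
Qed.

Lemma Delta_sign_sum x (m n : nat) :
  \sum_(i <- [:: m%:Z - 1; m%:Z]) \sum_(j <- [:: n%:Z - 1; n%:Z])
    (-1) ^ (m%:Z + n%:Z - i - j) * zterm x i j = Delta x m n.
Proof.
rewrite !big_cons !big_nil !addr0 /Delta.
have -> : m%:Z + n%:Z - (m%:Z - 1) - (n%:Z - 1) = 2 by ring.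
have -> : m%:Z + n%:Z - (m%:Z - 1) - n%:Z = 1 by ring.
have -> : m%:Z + n%:Z - m%:Z - (n%:Z - 1) = 1 by ring.
have -> : m%:Z + n%:Z - m%:Z - n%:Z = 0 by ring.
rewrite expr0z expr1z -[(-1) ^ 2]/((-1) ^+ 2) sqrrN expr1n.
by ring.
Qed.

Lemma partial_sum_Delta A x (m n : nat) :
  partial_sum (fun m n k l => Delta (fun a b => A a b k l) m n) x m n =
  fun s t => Delta (fun a b => partial_sum A x a b s t) m n.
Proof.
apply/funext => s; apply/funext => t.
have zterm_sum i j : zterm (fun a b => partial_sum A x a b s t) i j =
    \sum_(0 <= k < s.+1) \sum_(0 <= l < t.+1)
       zterm (fun a b => A a b k l) i j * x k l.
  by case: i j => i [] j //=; rewrite big1 // => k _; rewrite big1 // => l _;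
     rewrite mul0r.
rewrite /Delta !zterm_sum -!sumrB -big_split; apply: eq_bigr => k _.
rewrite /= -!sumrB -big_split; apply: eq_bigr => l _ /=.
by ring.
Qed.

(** Norms are valued in [K], which is only partially ordered when it is complex:
    instead of a maximum of two bounds, the proof halves a large enough one. *)
Lemma bounded_nearD {T : Type} (V : normedModType K) (f g : T -> V)
    (G : set_system T) {FG : Filter G} :
  bounded_near f G -> bounded_near g G -> bounded_near (fun t => f t + g t) G.
Proof.
move=> [M [Mreal fM]] [N [Nreal gN]]; rewrite /bounded_near; near=> B.
have fB : G [set t | `|f t| <= B / 2].
  by apply: fM; rewrite ltr_pdivlMr //; near: B; apply: nbhs_pinfty_gt;
     rewrite rpredM ?rpred_nat.
have gB : G [set t | `|g t| <= B / 2].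
  by apply: gN; rewrite ltr_pdivlMr //; near: B; apply: nbhs_pinfty_gt;
     rewrite rpredM ?rpred_nat.
apply: filterS2 fB gB => t /= ft gt.
by rewrite (le_trans (ler_normD _ _)) // [B]splitr lerD.
Unshelve. all: by end_near. Qed.

Lemma C_0 theta : C theta ((fun _ _ => 0) : dseq K).
Proof.
have c0 : p_cvg ((fun _ _ => 0) : dseq K) by exact: is_cvg_cst.
case: theta => //=; split => //; try by move=> ?; exact: is_cvg_cst.
exact: bounded_cst.
Qed.

Lemma C_add theta x y : C theta x -> C theta y ->
  C theta (fun s t => x s t + y s t).
Proof.
case: theta => /= [cx cy|[cx bx] [cy b_y]|[cx rx lx] [cy ry ly]].
- exact: is_cvgD.
- split; first exact: is_cvgD.
  exact: bounded_nearD.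
- by split; [exact: is_cvgD|move=> m; exact: is_cvgD|move=> n; exact: is_cvgD].
Qed.

Lemma C_opp theta x : C theta x -> C theta (fun s t => - x s t).
Proof.
case: theta => /= [cx|[cx bx]|[cx rx lx]].
- exact: is_cvgN.
- split; first exact: is_cvgN.
  by apply: sub_boundedl bx; apply: nearW => p; rewrite normrN.
- by split; [exact: is_cvgN|move=> m; exact: is_cvgN|move=> n; exact: is_cvgN].
Qed.

Lemma C_sum theta (P : nat -> dseq K) (n : nat) :
  (forall i, C theta (P i)) ->
  C theta (fun s t => \sum_(0 <= i < n) P i s t).
Proof.
move=> CP; elim: n => [|n IHn].
  by under eq_fun do under eq_fun do rewrite big_nil; exact: C_0.
under eq_fun do under eq_fun do rewrite big_nat_recr //=.
exact: C_add.
Qed.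

Lemma C_p_cvg theta x : C theta x -> p_cvg x.
Proof. by case: theta => [//|[]|[]]. Qed.

Lemma C_Delta_family theta (P : nat -> nat -> dseq K) (m n : nat) :
  (forall a b, C theta (P a b)) ->
  C theta (fun s t => Delta (fun a b => P a b s t) m n).
Proof.
move=> CP.
have Cz i j : C theta (fun s t => zterm (fun a b => P a b s t) i j).
  by case: i j => i [] j /=; by [exact: CP|exact: C_0].
by do ![apply: C_add|apply: C_opp|exact: Cz].
Qed.

Lemma p_lim_Delta (P : nat -> nat -> dseq K) (m n : nat) :
  (forall a b, p_cvg (P a b)) ->
  p_lim (fun s t => Delta (fun a b => P a b s t) m n) =
  Delta (fun a b => p_lim (P a b)) m n.
Proof.
move=> cP; apply: p_limE.
have cz i j : zterm (fun a b => P a b p.1 p.2) i j @[p --> (\oo, \oo)] -->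
    zterm (fun a b => p_lim (P a b)) i j.
  by case: i j => i [] j /=; by [exact: cP|exact: cvg_cst].
apply: cvgD (cz _ _).
by apply: cvgB (cz _ _); apply: cvgB; exact: cz.
Qed.

Section DifferencedMatrix.
Variables E F : matrix4 K.
Hypothesis FE : F = fun m n k l => Delta (fun a b => E a b k l) m n.

Lemma transform_exists_Delta theta x :
  transform_exists theta E x <-> transform_exists theta F x.
Proof.
split=> [Ex m n|Fx m n].
  by rewrite FE partial_sum_Delta; exact: C_Delta_family.
have -> : partial_sum E x m n = fun s t =>
    \sum_(0 <= i < m.+1) \sum_(0 <= j < n.+1) partial_sum F x i j s t.
  apply/funext => s; apply/funext => t.
  rewrite -[LHS](sum_Delta (fun a b => partial_sum E x a b s t)).
  by under [RHS]eq_bigr do under eq_bigr do rewrite FE partial_sum_Delta.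
by apply: C_sum => i; apply: C_sum => j; exact: Fx.
Qed.

Lemma transform_Delta theta x : transform_exists theta E x ->
  transform F x = Delta (transform E x).
Proof.
move=> Ex; apply/funext => m; apply/funext => n.
rewrite /transform FE partial_sum_Delta p_lim_Delta // => a b.
exact: C_p_cvg (Ex a b).
Qed.

End DifferencedMatrix.
End Difference.

Theorem theorem4p2 (R : realType) (kind : scalar_kind) (theta : conv_mode)
    (E F : matrix4 (scalars R kind)) (mu : set (dseq (scalars R kind))) :
  seq_space mu ->
  (forall k l m n : nat,
     F m n k l =
     \sum_(i <- [:: m%:Z - 1; m%:Z]) \sum_(j <- [:: n%:Z - 1; n%:Z])
        (-1) ^ (m%:Z + n%:Z - i - j) * zterm (fun a b => E a b k l) i j) ->
  matrix_class theta mu (C_Delta theta) E <-> matrix_class theta mu (C theta) F.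
Proof.
move=> _ Frel.
have FE : F = fun m n k l => Delta (fun a b => E a b k l) m n.
  apply/funext => m; apply/funext => n; apply/funext => k; apply/funext => l.
  by rewrite Frel Delta_sign_sum.
split=> H x /H [].
  move=> Ex DEx; split; first exact/(transform_exists_Delta _ _ _ FE).
  by rewrite (transform_Delta _ _ _ FE _ _ Ex).
move=> /(transform_exists_Delta _ _ _ FE) Ex CFx; split=> //.
by rewrite /C_Delta /= -(transform_Delta _ _ _ FE _ _ Ex).
Qed.
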